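(* Let $A=(a_1,a_2,\dots)$ be an infinite sequence of real numbers with $a_i\in[0,1]$ for all $i$ and $\sum_{i} a_i=\infty$, and let $a\ge 0$ be a real number. Then there is a partition of $A$ into blocks $B_1,B_2,\dots$ with sizes $b_1,b_2,\dots$ such that $\inf_i b_i\le a\le \sup_i b_i\le \inf_i b_i+1$.
   Context: A block of a sequence is either the empty set or a set of consecutive terms $\{a_i,a_{i+1},\dots,a_j\}$ with $i\le j$; its size is the sum of its elements (the empty block has size $0$). A partition of the infinite sequence $A$ into blocks $B_1,B_2,\dots$ is given by a nondecreasing sequence of integers $0=x_0\le x_1\le x_2\le\dots$ with $x_i\to\infty$ and $B_i=\{a_j: x_{i-1}<j\le x_i\}$; every term lies in exactly one block, blocks appear in order, and empty blocks are allowed. *)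

(* Defs.v *)
From HB Require Import structures.
From mathcomp Require Import all_boot all_order all_algebra.
From mathcomp Require Import all_classical all_reals all_analysis.
Import Order.TTheory GRing.Theory Num.Theory.

Set Implicit Arguments.
Unset Strict Implicit.
Unset Printing Implicit Defensive.

Local Open Scope classical_set_scope.
Local Open Scope ring_scope.

(* Sequences are indexed from 0: [a j] is the term a_{j+1}, and block number
   [i] is B_{i+1}, i.e. the terms a_{j+1} with x_i < j + 1 <= x_{i+1}. *)

Definition block_partition (x : nat -> nat) : Prop :=
  [/\ x 0%N = 0%N,
      {homo x : i j / (i <= j)%N} &
      x n @[n --> \oo] --> \oo].

Definition block_size (R : realType) (a : nat -> R) (x : nat -> nat)
    (i : nat) : R :=
  \sum_(x i <= j < x i.+1) a j.

(* Main.v *)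
(* If the supremum of the terms is at least [a], one empty block followed by
   singletons works. Otherwise let [m] > 0 be the supremum of the thresholds for
   which cutting a block as soon as its size is >= the threshold yields only
   blocks of size <= [a]. Continuity from the left and from the right gives two
   partitions with all sizes in [m, m + 1]: [p] with sizes <= [a], and [q] (cut
   as soon as the size is > [m]) with sizes >= [a]. If neither has [a] between
   its infimum and supremum, the sizes of [p] and [q] stay a fixed distance away
   from [a], so the [i]-th cut of [q] eventually overtakes the [i+1]-st cut of
   [p]; switching from [p] to [q] at the first overtaking keeps all sizes in
   [m, m + 1] and uses sizes on both sides of [a]. *)
Require Import Defs.
From HB Require Import structures.
From mathcomp Require Import all_boot all_order all_algebra.
From mathcomp Require Import all_classical all_reals all_analysis.
From mathcomp Require Import lra.
Import Order.TTheory GRing.Theory Num.Theory.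

Set Implicit Arguments.
Unset Strict Implicit.
Unset Printing Implicit Defensive.

Local Open Scope classical_set_scope.
Local Open Scope ring_scope.

(** * Partial sums, cut sequences and block sizes *)

Definition psum (R : realType) (A : nat -> R) (n : nat) : R :=
  \sum_(0 <= j < n) A j.

(** Minimality ranges over every [q] below [x i.+1], even those before [x i], so each cut is
    determined by the previous one. *)
Definition greedy (R : realType) (A : nat -> R) (D : pred R) (x : nat -> nat) :=
  x 0 = 0%N /\ forall i, D (psum A (x i.+1) - psum A (x i)) /\
    forall q, (q < x i.+1)%N -> ~~ D (psum A q - psum A (x i)).

Definition steps_in (R : realType) (A : nat -> R) (m : R) (x : nat -> nat) :=
  x 0 = 0%N /\ forall i, m <= psum A (x i.+1) - psum A (x i) <= m + 1.

Definition straddles (R : realType) (a : R) (b : nat -> R) :=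
  (forall e, 0 < e -> exists i, b i < a + e) /\
  (forall e, 0 < e -> exists i, a - e < b i).

Lemma psum0 (R : realType) (A : nat -> R) : psum A 0 = 0.
Proof. by rewrite /psum big_nil. Qed.

Lemma psumS (R : realType) (A : nat -> R) n : psum A n.+1 = psum A n + A n.
Proof. by rewrite /psum big_nat_recr. Qed.

Lemma psum_homo (R : realType) (A : nat -> R) :
  (forall i, 0 <= A i) -> {homo psum A : m n / (m <= n)%N >-> m <= n}.
Proof. by move=> A0; apply: homo_leq => // [y x z|n]; [apply: le_trans|rewrite psumS lerDl]. Qed.

Lemma psum_unbounded (R : realType) (A : nat -> R) :
  (forall i, 0 <= A i) -> (\sum_(0 <= i <oo) (A i)%:E = +oo)%E ->
  forall M, exists n, M < psum A n.
Proof.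
move=> A0 Aoo M; apply: contrapT => /forallNP bnd.
suff : (\sum_(0 <= i <oo) (A i)%:E <= M%:E)%E by rewrite Aoo.
apply: lime_le; first by apply: is_cvg_nneseries => n _ _; rewrite lee_fin.
apply: nearW => n; rewrite sumEFin lee_fin leNgt; exact/negP/bnd.
Qed.

Lemma block_sizeE (R : realType) (A : nat -> R) (x : nat -> nat) i :
  (x i <= x i.+1)%N -> block_size A x i = psum A (x i.+1) - psum A (x i).
Proof.
move=> xi; rewrite /block_size /psum [X in _ = X - _](big_cat_nat (n := x i)) //=.
by rewrite addrAC subrr add0r.
Qed.

(** Since [m > 0] and partial sums are monotone, the cuts increase strictly, hence [x k >= k]. *)
Lemma block_partition_steps_in (R : realType) (A : nat -> R) m x :
  (forall i, 0 <= A i) -> 0 < m -> steps_in A m x ->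
  block_partition x /\
  forall i, block_size A x i = psum A (x i.+1) - psum A (x i).
Proof.
move=> A0 m0 [x0 xP].
have x_lt i : (x i < x i.+1)%N.
  rewrite ltnNge; apply/negP => /(psum_homo A0); have := xP i; lra.
split; last by move=> i; rewrite block_sizeE // ltnW.
split=> //; first by apply: homo_leq => // [y ? z|n]; [exact: leq_trans|exact: ltnW].
apply/cvgnyPge => n; near=> k.
have: (n <= k)%N by near: k; exact: nbhs_infty_ge.
move=> /leq_trans; apply; elim: (k) => // j /leq_ltn_trans; apply; exact: x_lt.
Unshelve. all: by end_near. Qed.

Lemma straddles_ereal (R : realType) (a m : R) (b : nat -> R) :
  straddles a b -> (forall i, m <= b i <= m + 1) ->
  let B := fun i => (b i)%:E in
  [/\ (ereal_inf (range B) <= a%:E)%E,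
      (a%:E <= ereal_sup (range B))%E &
      (ereal_sup (range B) <= ereal_inf (range B) + 1)%E].
Proof.
move=> [lo hi] bm B; split.
- apply/lee_addgt0Pr => e /lo [i bi].
  by apply: ge_ereal_inf; exists (B i); [exists i|rewrite /B -EFinD lee_fin ltW].
- apply/lee_subgt0Pr => e /hi [i bi].
  by apply: le_ereal_sup_tmp; exists (B i); [exists i|rewrite /B -EFinB lee_fin ltW].
- apply: (@le_trans _ _ (m%:E + 1)%E).
    apply: ge_ereal_sup => _ [i _ <-]; rewrite -EFinD lee_fin.
    by case/andP: (bm i).
  rewrite leeD2r//; apply: le_ereal_inf_tmp => _ [i _ <-]; rewrite lee_fin.
  by case/andP: (bm i).
Qed.

(** * Greedy cuts and their stability in the threshold *)

Lemma greedy_exists (R : realType) (A : nat -> R) (D : pred R) :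
  (forall p, exists q, D (psum A q - psum A p)) -> exists x, greedy A D x.
Proof.
move=> DP.
exists (fun n => iter n (fun p => ex_minn (DP p)) 0%N); split=> // i /=.
case: ex_minnP => q Dq qmin; split=> // r rq; apply/negP => /qmin.
by rewrite leqNgt rq.
Qed.

Lemma greedy_eq (R : realType) (A : nat -> R) (D D' : pred R) x y n :
  greedy A D x -> greedy A D' y ->
  (forall i, (i < n)%N -> D' (psum A (x i.+1) - psum A (x i)) /\
    forall q, (q < x i.+1)%N -> ~~ D' (psum A q - psum A (x i))) ->
  forall i, (i <= n)%N -> x i = y i.
Proof.
move=> [x0 _] [y0 yP] xP; elim=> [|i IH] lin; first by rewrite x0 y0.
have [Dx Dx'] := xP i lin; have [Dy Dy'] := yP i.
have xy := IH (ltnW lin); rewrite -xy in Dy Dy'.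
have [lt_xy|lt_yx|//] := ltngtP (x i.+1) (y i.+1).
  by have := Dy' _ lt_xy; rewrite Dx.
by have := Dx' _ lt_yx; rewrite Dy.
Qed.

(** The sum before the last term is at most [m], and that term adds at most [e]. The value [D m] is
    left open, which covers both rules [>= m] and [> m]. *)
Lemma greedy_step_le (R : realType) (A : nat -> R) (D : pred R) (m e : R) x i :
  (forall j, 0 <= A j <= e) -> 0 < m ->
  (forall s, s < m -> ~~ D s) -> (forall s, m < s -> D s) -> greedy A D x ->
  m <= psum A (x i.+1) - psum A (x i) <= m + e.
Proof.
move=> Ae m0 Dlt Dgt [_ /(_ i) [Dx Dx']]; apply/andP; split.
  by rewrite leNgt; apply/negP => /Dlt; rewrite Dx.
have A0 j : 0 <= A j by case/andP: (Ae j).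
case E : (x i.+1) Dx Dx' => [|q] Dx Dx'.
  by exfalso; move: Dx; apply/negP/Dlt; have := psum_homo A0 (leq0n (x i)); lra.
have : psum A q - psum A (x i) <= m.
  by rewrite leNgt; apply/negP => /Dgt; apply/negP/Dx'.
rewrite psumS; have := Ae q; lra.
Qed.

(** Rejected sums are strictly below [m], and by monotonicity the last one before each cut is the
    largest; the first [n] cuts thus leave a common slack [d]. *)
Lemma greedy_left (R : realType) (A : nat -> R) (m : R) x n :
  (forall i, 0 <= A i) -> greedy A (>= m) x ->
  exists2 d, 0 < d & forall m' y, m - d < m' <= m -> greedy A (>= m') y ->
    forall i, (i <= n)%N -> x i = y i.
Proof.
move=> A0 gx; have [_ xP] := gx.
suff [d d0 dP] : exists2 d, 0 < d & forall i, (i < n)%N ->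
    forall q, (q < x i.+1)%N -> psum A q - psum A (x i) <= m - d.
  exists d => // m' y mm' gy; apply: (greedy_eq gx gy) => i ilt.
  have [/= Dx _] := xP i; split => /=; first by move: Dx; lra.
  by move=> q /(dP i ilt q); rewrite -ltNge; lra.
elim: n => [|n [d d0 dP]]; first by exists 1.
have [e e0 eP] : exists2 e, 0 < e & forall q, (q < x n.+1)%N ->
    psum A q - psum A (x n) <= m - e.
  have [/= _] := xP n; case: (x n.+1) => [|r] Dx'; first by exists 1.
  have /= := Dx' r (ltnSn r); rewrite -ltNge => rm.
  exists (m - (psum A r - psum A (x n))); first by lra.
  by move=> q; rewrite ltnS => /(psum_homo A0); lra.
exists (Num.min d e); first by rewrite lt_min d0.
have [ge_d ge_e] : Num.min d e <= d /\ Num.min d e <= e.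
  by rewrite !ge_min !lexx orbT.
move=> i; rewrite ltnS leq_eqVlt => /orP[/eqP -> q /eP|ilt q /(dP i ilt)]; lra.
Qed.

(** Dually, the first [n] accepted sums exceed [m] strictly, which leaves room to raise the
    threshold. *)
Lemma greedy_right (R : realType) (A : nat -> R) (m : R) x n :
  greedy A (> m) x ->
  exists2 d, 0 < d & forall m' y, m < m' < m + d -> greedy A (>= m') y ->
    forall i, (i <= n)%N -> x i = y i.
Proof.
move=> gx; have [_ xP] := gx.
suff [d d0 dP] : exists2 d, 0 < d & forall i, (i < n)%N ->
    m + d <= psum A (x i.+1) - psum A (x i).
  exists d => // m' y mm' gy; apply: (greedy_eq gx gy) => i ilt.
  have [/= _ Dx'] := xP i; split => /=; first by move: (dP i ilt); lra.
  by move=> q /Dx' /=; rewrite -leNgt -ltNge; lra.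
elim: n => [|n [d d0 dP]]; first by exists 1.
have [/= Dx _] := xP n.
set e := psum A (x n.+1) - psum A (x n) - m.
have e0 : 0 < e by rewrite /e; lra.
exists (Num.min d e); first by rewrite lt_min d0.
have [ge_d ge_e] : Num.min d e <= d /\ Num.min d e <= e.
  by rewrite !ge_min !lexx orbT.
move=> i; rewrite ltnS leq_eqVlt => /orP[/eqP ->|/dP]; last lra.
by move: ge_e; rewrite /e; lra.
Qed.

(** * Switching between two partitions, and the critical threshold *)

Lemma not_straddles (R : realType) (a : R) (b : nat -> R) :
  ~ straddles a b ->
  (exists2 e, 0 < e & forall i, a + e <= b i) \/
  (exists2 e, 0 < e & forall i, b i <= a - e).
Proof.
move=> nab; apply: contrapT => /not_orP[lo hi]; apply: nab; split=> e e0.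
  apply: contrapT => /forallNP H; apply: lo; exists e => // i.
  by rewrite leNgt; exact/negP.
apply: contrapT => /forallNP H; apply: hi; exists e => // i.
by rewrite leNgt; exact/negP.
Qed.

Lemma switch_straddles (R : realType) (A : nat -> R) (a m e : R) p q :
  0 < m -> 0 < e -> steps_in A m p -> steps_in A m q ->
  (forall i, psum A (p i.+1) - psum A (p i) <= a - e) ->
  (forall i, a + e <= psum A (q i.+1) - psum A (q i)) ->
  exists2 x, steps_in A m x &
    straddles a (fun i => psum A (x i.+1) - psum A (x i)).
Proof.
move=> m0 e0 [p0 pm] [q0 qm] pa qa.
(* Each step shrinks the gap by at least [2 * e]; the rate [e] is enough. *)
have gap i : psum A (p i.+1) - psum A (q i) <= psum A (p 1) - i%:R * e.
  elim: i => [|i IH]; first by rewrite q0 psum0; lra.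
  rewrite -natr1; have := pa i.+1; have := qa i; lra.
have crossing : exists i, psum A (p i.+1) <= psum A (q i).
  exists (Num.bound (psum A (p 1) / e)).
  have := gap (Num.bound (psum A (p 1) / e)).
  have : psum A (p 1) < (Num.bound (psum A (p 1) / e))%:R * e.
    rewrite -ltr_pdivrMr//; apply: archi_boundP; apply: divr_ge0; last exact: ltW.
    by have := pm 0%N; rewrite p0 psum0; lra.
  lra.
case: (ex_minnP crossing) => -[|j] cj jmin.
  by exfalso; move: cj; have := pm 0%N; rewrite p0 q0 psum0; lra.
have cj' : psum A (q j) < psum A (p j.+1).
  by rewrite ltNge; apply/negP => /jmin; rewrite ltnn.
(* The joining block runs from [p j.+1] to [q j.+1]. By [cj] it is at least the [p]-block starting
   at [p j.+1], so at least [m]; by [cj'] it is less than the [q]-block starting at [q j], so at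
   most [m + 1]. *)
exists (fun k => if (k <= j.+1)%N then p k else q k.-1).
  split=> // i; have [ij|ij|->] := ltngtP i j.+1.
  - exact: pm.
  - by case: i ij => // i _; exact: qm.
  - by have := pm j.+1; have := qm j; lra.
split=> d d0.
  by exists 0%N; rewrite /=; have := pa 0%N; lra.
exists j.+2; rewrite ltnn ltnNge leqnSn /=; have := qa j.+1; lra.
Qed.

Lemma exists_straddling_steps (R : realType) (A : nat -> R) (a e : R) :
  (forall i, 0 <= A i <= e) -> e <= 1 -> e < a ->
  (forall M, exists n, M < psum A n) ->
  exists (m : R) x, [/\ 0 < m, steps_in A m x &
    straddles a (fun i => psum A (x i.+1) - psum A (x i))].
Proof.
move=> Ae e1 ea unb; have A0 i : 0 <= A i by case/andP: (Ae i).
have ge_ex (m : R) : exists x, greedy A (>= m) x.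
  apply: greedy_exists => p; have [q qP] := unb (m + psum A p).
  by exists q => /=; lra.
have gt_ex (m : R) : exists x, greedy A (> m) x.
  apply: greedy_exists => p; have [q qP] := unb (m + psum A p).
  by exists q => /=; lra.
have ge_le (m : R) x i : 0 < m -> greedy A (>= m) x ->
    m <= psum A (x i.+1) - psum A (x i) <= m + e.
  by move=> m0; apply: greedy_step_le => // s /=; rewrite -?ltNge //; exact: ltW.
have gt_le (m : R) x i : 0 < m -> greedy A (> m) x ->
    m <= psum A (x i.+1) - psum A (x i) <= m + e.
  by move=> m0; apply: greedy_step_le => // s /=; rewrite -?leNgt //; exact: ltW.
apply: contrapT => none.
have dicho (m : R) x : 0 < m -> steps_in A m x ->
    (exists2 d, 0 < d & forall i, a + d <= psum A (x i.+1) - psum A (x i)) \/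
    (exists2 d, 0 < d & forall i, psum A (x i.+1) - psum A (x i) <= a - d).
  move=> m0 mx; apply: not_straddles => ax; apply: none; by exists m, x.
(* Quantifying over all [x] is harmless: by [greedy_eq] the greedy cuts are unique. *)
pose E := [set m : R | 0 < m /\ forall x, greedy A (>= m) x ->
  forall i, psum A (x i.+1) - psum A (x i) <= a].
have Ea : ubound E a.
  move=> m [m0 mE]; have [x gx] := ge_ex m.
  have := mE x gx 0%N; have := ge_le m x 0%N m0 gx; lra.
(* Here [e < a] makes the threshold positive, and its blocks have size at most [(a - e) + e]. *)
have Em0 : E (a - e).
  by split=> [|x gx i]; [lra|have := ge_le (a - e) x i _ gx; lra].
have supE : has_sup E by split; [exists (a - e)|exists a].
set s := sup E.
have s0 : 0 < s.
  by have := ub_le_sup (ex_intro _ a Ea) Em0; rewrite -/s; lra.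
have [p gp] := ge_ex s; have [q gq] := gt_ex s.
have ps : steps_in A s p.
  by split=> [|i]; [case: gp|have := ge_le s p i s0 gp; lra].
have qs : steps_in A s q.
  by split=> [|i]; [case: gq|have := gt_le s q i s0 gq; lra].
(* A threshold of [E] close enough to [s] has the same cuts as [p] up to index [i.+1]. *)
have pa i : psum A (p i.+1) - psum A (p i) <= a.
  have [d d0 dP] := greedy_left i.+1 A0 gp.
  have [m Em lt_m] := sup_adherent d0 supE.
  have m_le : m <= s by apply: ub_le_sup => //; exists a.
  have [x gx] := ge_ex m; have px := dP m x _ gx.
  by rewrite !px ?leqnSn //; [case: Em => _; apply|rewrite lt_m m_le..].
(* The threshold [m], chosen for this [i], exceeds [s], so it is outside [E] and [dicho] puts all
   its sizes above [a]; its cuts agree with [q] up to [i.+1]. *)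
have qa i : a <= psum A (q i.+1) - psum A (q i).
  have [d d0 dP] := greedy_right i.+1 gq.
  pose m := s + d / 2; have [x gx] := ge_ex m.
  have m0 : 0 < m by rewrite /m; lra.
  have mx : steps_in A m x.
    by split=> [|j]; [case: gx|have := ge_le m x j m0 gx; lra].
  have sm : s < m < s + d by rewrite /m; lra.
  have qx := dP m x sm gx; rewrite !qx ?leqnSn //.
  have [[c c0 cP]|[c c0 cP]] := dicho m x m0 mx; first by have := cP i; lra.
  have Em : E m.
    split=> // y gy j.
    have xy : forall k, (k <= j.+1)%N -> x k = y k.
      by apply: (greedy_eq gx gy) => k _; case: gx => _; apply.
    by rewrite -!xy ?leqnSn //; have := cP j; lra.
  have : m <= s by apply: ub_le_sup => //; exists a.
  lra.
have [[c c0 cP]|[c c0 cP]] := dicho s p s0 ps.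
  by have := cP 0%N; have := pa 0%N; lra.
have [[d d0 dP]|[d d0 dP]] := dicho s q s0 qs; last first.
  by have := dP 0%N; have := qa 0%N; lra.
have [ge_c ge_d] : Num.min c d <= c /\ Num.min c d <= d.
  by rewrite !ge_min !lexx orbT.
have [x sx ax] : exists2 x, steps_in A s x &
    straddles a (fun i => psum A (x i.+1) - psum A (x i)).
  apply: (@switch_straddles _ _ _ _ (Num.min c d) p q) => //.
  - by rewrite lt_min c0.
  - by move=> i; have := cP i; lra.
  - by move=> i; have := dP i; lra.
by apply: none; exists s, x.
Qed.

Local Open Scope ereal_scope.

Theorem theorem3p1 (R : realType) (A : nat -> R) (a : R)
    (hA : forall i : nat, (0 <= A i <= 1)%R)
    (hsum : \sum_(0 <= i <oo) (A i)%:E = +oo)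
    (ha : (0 <= a)%R) :
  exists x : nat -> nat,
    block_partition x /\
    let b := fun i : nat => (block_size A x i)%:E in
    [/\ ereal_inf (range b) <= a%:E,
        a%:E <= ereal_sup (range b) &
        ereal_sup (range b) <= ereal_inf (range b) + 1].
Proof.
have A0 i : (0 <= A i)%R by case/andP: (hA i).
have [small|/existsNP[e /not_implyP[ea /forallNP eA]]] :=
    pselect (forall e, e < a -> exists i, e < A i)%R.
  (* As cuts, [predn] reads 0, 0, 1, 2, ...; all sizes lie between 0 and 1, so [m = 0] serves
     below. *)
  exists predn; split.
    split=> //; first by move=> i j ij; rewrite -!subn1 leq_sub2r.
    apply/cvgnyPge => n; near=> k.
    have : (n.+1 <= k)%N by near: k; exact: nbhs_infty_ge.
    by move=> nk; rewrite -ltnS; apply: (leq_trans nk); exact: leqSpred.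
  have b0 : block_size A predn 0 = 0%R by rewrite /block_size big_geq.
  have bS i : block_size A predn i.+1 = A i by rewrite /block_size big_nat1.
  apply: (@straddles_ereal _ _ 0%R); last first.
    by case=> [|i]; rewrite ?b0 ?bS add0r // lexx ler01.
  split=> d d0; first by exists 0%N; rewrite b0; lra.
  by have [|i di] := small (a - d)%R; [lra|exists i.+1; rewrite bS].
have Ae i : (A i <= e)%R by rewrite leNgt; exact/negP/eA.
(* The bound [Num.min e 1] is both below [a] and at most 1. *)
have [||//|m [x [m0 mx ax]]] :=
    @exists_straddling_steps _ A a (Num.min e 1)%R _ _ _ (psum_unbounded A0 hsum).
- by move=> i; rewrite le_min A0 Ae; case/andP: (hA i).
- by rewrite ge_min lexx orbT.
- by rewrite gt_min ea.
have [px bE] := block_partition_steps_in A0 m0 mx.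
exists x; split=> //; apply: (@straddles_ereal _ _ m).
  by rewrite (funext bE).
by move=> i; rewrite bE; case: mx.
Unshelve. all: by end_near. Qed.
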